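(* Let $A, B, C \in \mathbb{C}^{n\times n}$. If $A \in \mathcal{B}(B)$ and $B \in \overline{\mathcal{B}(C)}$, then $A \in \overline{\mathcal{B}(C)}$.
   Context: For a matrix $M\in\mathbb{C}^{n\times n}$, its similarity orbit is $\mathcal{O}(M)=\{S^{-1}MS : S\in GL_n(\mathbb{C})\}$. The bundle $\mathcal{B}(M)\subset\mathbb{C}^{n\times n}$ of $M$ is the union of all similarity orbits of $n\times n$ matrices having the same Jordan structure as $M$, except that the values of the distinct eigenvalues may be different. Explicitly, let $\lambda_1,\dots,\lambda_r$ be the distinct eigenvalues of $M$, and let the Jordan canonical form of $M$ be $\bigoplus_{i=1}^{r}\bigoplus_{j=1}^{t_i} J_{k_{i,j}}(\lambda_i)$, where $J_k(\lambda)$ is the $k\times k$ Jordan block with eigenvalue $\lambda$ and, for each $i$, $k_{i,1}\ge k_{i,2}\ge\dots\ge k_{i,t_i}$. Then $N\in\mathcal{B}(M)$ if and only if there exist pairwise distinct complex numbers $\mu_1,\dots,\mu_r$ such that $N$ is similar to $\bigoplus_{i=1}^{r}\bigoplus_{j=1}^{t_i} J_{k_{i,j}}(\mu_i)$ (same $r$, $t_i$ and $k_{i,j}$). The bar $\overline{\,\cdot\,}$ denotes the closure in $\mathbb{C}^{n\times n}$ with its usual topology (e.g., that induced by the Frobenius norm). *)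

(* Defs.v *)
From HB Require Import structures.
From mathcomp Require Import all_boot all_order all_algebra.
From mathcomp Require Import classical_sets reals topology normedtype.
From mathcomp Require Export complex.
Export numFieldNormedType.Exports.

Set Implicit Arguments.
Unset Strict Implicit.
Unset Printing Implicit Defensive.

Import GRing.Theory.

Local Open Scope classical_set_scope.
Local Open Scope ring_scope.

Section complex_topology.
Local Open Scope complex_scope.

(* The topology given by the complex modulus: the numFieldType instances of
   numFieldNormedType do not fire on the concrete type R[i]. *)
HB.instance Definition _ (R : realType) :=
  GRing.ComAlgebra.copy R[i] R[i]^o.
HB.instance Definition _ (R : realType) := Vector.copy R[i] R[i]^o.
HB.instance Definition _ (R : realType) :=
  NormedModule.copy R[i] R[i]^o.

End complex_topology.

Definition similarity_orbit (F : fieldType) (n : nat) (M : 'M[F]_n) :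
    set 'M[F]_n :=
  [set invmx S *m M *m S | S in [set S : 'M[F]_n | S \in unitmx]].

Definition jordan_block (F : fieldType) (k : nat) (lambda : F) : 'M[F]_k :=
  \matrix_(i < k, j < k) (lambda *+ (i == j) + (i.+1 == j :> nat)%:R).

(* The combinatorial part (r, t_i, k_{i,j}) of a Jordan canonical form of size
   n: r eigenvalues, and for the i-th one t_i >= 1 blocks of positive sizes
   k_{i,1} >= ... >= k_{i,t_i}. *)
Record jordan_structure (n : nat) := JordanStructure {
  js_r : nat;
  js_t : 'I_js_r -> nat;
  js_k : forall i : 'I_js_r, 'I_(js_t i) -> nat;
  js_t_gt0 : forall i, (0 < js_t i)%N;
  js_k_gt0 : forall i j, (0 < @js_k i j)%N;
  js_k_noninc : forall i (j1 j2 : 'I_(js_t i)),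
    (j1 <= j2)%N -> (@js_k i j2 <= @js_k i j1)%N;
  js_dim : (\sum_(i < js_r) \sum_(j < js_t i) @js_k i j)%N = n
}.
Arguments js_r {n}.
Arguments js_t {n}.
Arguments js_k {n}.

Definition jordan_form (F : fieldType) (n : nat) (s : jordan_structure n)
    (lambda : 'I_(js_r s) -> F) : 'M[F]_n :=
  castmx (js_dim s, js_dim s)
    (\mxdiag_(i < js_r s) \mxdiag_(j < js_t s i)
       jordan_block (js_k s i j) (lambda i)).

Definition bundle (F : fieldType) (n : nat) (M : 'M[F]_n) : set 'M[F]_n :=
  [set N | exists (s : jordan_structure n) (lambda mu : 'I_(js_r s) -> F),
    [/\ injective lambda, similarity_orbit (jordan_form lambda) M,
        injective mu & similarity_orbit (jordan_form mu) N]].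

(* Main.v *)
(* Write [B ~ J_s(l)] and [A ~ J_s(m)] and choose a polynomial [p] with
   [p (l i) = m i] and [p' (l i) = 1].  As [p] is a local isomorphism at the
   eigenvalues of [B], [p(J_s(l)) ~ J_s(m)], so that [A ~ p(B)].  It remains to see
   that [X |-> p(X)] maps the closure of [bundle C] to itself.  By continuity it
   is enough that [p(X)] is in the closure for [X] in [bundle C]; and for all
   small nonzero [e] the polynomial [p + e *: 'X] is injective on the
   eigenvalues of [X] with nonzero derivative there, so that
   [p(X) + e *: X] is in [bundle C].  This genericity argument avoids the
   continuity of eigenvalues. *)
Require Import Defs.
From mathcomp Require Import all_boot all_order all_algebra.
From mathcomp Require Import classical_sets reals topology normedtype.
From mathcomp Require Import ring.

Set Implicit Arguments.
Unset Strict Implicit.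
Unset Printing Implicit Defensive.

Import Order.TTheory GRing.Theory Num.Theory.

Local Open Scope classical_set_scope.
Local Open Scope ring_scope.
Local Open Scope complex_scope.

(** * Similarity orbits *)

Section similarity.
Variable F : fieldType.

Lemma similarity_orbitP n (M N : 'M[F]_n) :
  similarity_orbit M N <-> exists2 S, S \in unitmx & S *m N = M *m S.
Proof.
split=> [[S /= uS <-]|[S uS e]]; exists S => //.
  by rewrite -mulmxA mulKVmx.
by rewrite /= -mulmxA -e mulKmx.
Qed.

Lemma similarity_orbit_sym n (M N : 'M[F]_n) :
  similarity_orbit M N -> similarity_orbit N M.
Proof.
case=> S /= uS <-; exists (invmx S); rewrite /= ?unitmx_inv //.
by rewrite invmxK -mulmxA mulmxK // mulKVmx.
Qed.

Lemma similarity_orbit_trans n (M N P : 'M[F]_n) :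
  similarity_orbit M N -> similarity_orbit N P -> similarity_orbit M P.
Proof.
move=> /similarity_orbitP[S uS eS] /similarity_orbitP[T uT eT].
apply/similarity_orbitP; exists (S *m T); first by rewrite unitmx_mul uS.
by rewrite -mulmxA eT mulmxA eS mulmxA.
Qed.

Lemma similarity_orbit_castmx m n (e : m = n) (M N : 'M[F]_m) :
  similarity_orbit M N -> similarity_orbit (castmx (e, e) M) (castmx (e, e) N).
Proof. by case: n / e; rewrite !castmx_id. Qed.

Lemma mul_mxdiag p (p_ : 'I_p -> nat) (D E : forall i, 'M[F]_(p_ i)) :
  \mxdiag_i D i *m \mxdiag_i E i = \mxdiag_i (D i *m E i).
Proof.
(* Only the right factor is opened as a full block matrix; its diagonal blocks carry a [conform_mx],
   which is the identity once the two indices agree. *)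
rewrite [in RHS]/mxdiag [X in _ *m X]/mxdiag mul_mxdiag_mxblock.
apply/eq_mxblock => i j; case: eqVneq => [<-|_]; last by rewrite mulmx0.
by rewrite !conform_mx_id.
Qed.

Lemma similarity_orbit_mxdiag p (p_ : 'I_p -> nat)
    (D E : forall i, 'M[F]_(p_ i)) :
  (forall i, similarity_orbit (D i) (E i)) ->
  similarity_orbit (\mxdiag_i D i) (\mxdiag_i E i).
Proof.
(* A conjugator must be chosen for every block at once; together they form a block diagonal
   conjugator, whose inverse is built blockwise. *)
move=> DE; have /all_sig2[S uS eS] i : {S | S \in unitmx & S *m E i = D i *m S}.
  by apply/boolp.cid2/similarity_orbitP.
apply/similarity_orbitP; exists (\mxdiag_i S i); last first.
  by rewrite !mul_mxdiag; apply/eq_mxdiag.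
apply: (@mulmx1_unit _ _ _ (\mxdiag_i invmx (S i)) _).1.
rewrite mul_mxdiag -mxdiagZ; apply/eq_mxdiag => i; exact: mulmxV.
Qed.

End similarity.

(** * Polynomials in a square matrix *)

(* [horner_mx] is restricted to sizes of the form [n.+1], which neither the
   size [n] nor the block sizes [js_k] are. *)
Definition hornermx (F : fieldType) (n : nat) : {poly F} -> 'M[F]_n -> 'M[F]_n :=
  if n is m.+1 then fun p M => horner_mx M p else fun _ M => M.

Section hornermx.
Variables (F : fieldType).
Implicit Types p q : {poly F}.

Lemma hornermxC n c (M : 'M[F]_n) : hornermx c%:P M = c%:M.
Proof. by case: n M => [|n] M; [rewrite !thinmx0 | exact: horner_mx_C]. Qed.

Lemma hornermxX n (M : 'M[F]_n) : hornermx 'X M = M.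
Proof. by case: n M => [|n] M //; exact: horner_mx_X. Qed.

Lemma hornermxD n p q (M : 'M[F]_n) :
  hornermx (p + q) M = hornermx p M + hornermx q M.
Proof. by case: n M => [|n] M; [rewrite !thinmx0 | exact: rmorphD]. Qed.

Lemma hornermxM n p q (M : 'M[F]_n) :
  hornermx (p * q) M = hornermx p M *m hornermx q M.
Proof. by case: n M => [|n] M; [rewrite [RHS]thinmx0 thinmx0 | exact: rmorphM]. Qed.

Lemma hornermx_MXaddC n p c (M : 'M[F]_n) :
  hornermx (p * 'X + c%:P) M = hornermx p M *m M + c%:M.
Proof. by rewrite hornermxD hornermxM hornermxX hornermxC. Qed.

Lemma hornermx0 n (M : 'M[F]_n) : hornermx 0 M = 0.
Proof. by rewrite -polyC0 hornermxC raddf0. Qed.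

(** The relation passes through products and scalars. With [S] invertible it gives invariance under
    similarity; with [M = N], that [p(M)] commutes with whatever commutes with [M]. *)
Lemma hornermx_intertwine n p (S M N : 'M[F]_n) :
  S *m M = N *m S -> S *m hornermx p M = hornermx p N *m S.
Proof.
move=> e; elim/poly_ind: p => [|p c IH]; first by rewrite !hornermx0 mulmx0 mul0mx.
by rewrite !hornermx_MXaddC mulmxDr mulmxDl mulmxA IH -!mulmxA e scalar_mxC.
Qed.

Lemma similarity_orbit_hornermx n p (M N : 'M[F]_n) :
  similarity_orbit M N -> similarity_orbit (hornermx p M) (hornermx p N).
Proof.
move=> /similarity_orbitP[S uS e]; apply/similarity_orbitP; exists S => //.
exact: hornermx_intertwine.
Qed.

Lemma hornermx_castmx m n (e : m = n) p (M : 'M[F]_m) :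
  hornermx p (castmx (e, e) M) = castmx (e, e) (hornermx p M).
Proof. by case: n / e; rewrite !castmx_id. Qed.

Lemma hornermx_mxdiag r (p_ : 'I_r -> nat) p (D : forall i, 'M[F]_(p_ i)) :
  hornermx p (\mxdiag_i D i) = \mxdiag_i hornermx p (D i).
Proof.
elim/poly_ind: p => [|p c IH].
  by rewrite hornermx0 -[LHS]mxdiag0; apply/eq_mxdiag => i; rewrite hornermx0.
rewrite hornermx_MXaddC IH mul_mxdiag -mxdiagZ -mxdiagD.
by apply/eq_mxdiag => i; rewrite hornermx_MXaddC.
Qed.

End hornermx.

(** * Polynomials in a Jordan form *)

Section jordan.
Variable F : fieldType.
Implicit Types p q : {poly F}.

(** The constant diagonal value is part of the predicate, so that it can be tracked through sums and
    products and invertibility of [q(J)] can be read off [q.[l]]. *)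
Definition upper_trig n (a : F) (M : 'M[F]_n) :=
  forall i j : 'I_n, (j <= i)%N -> M i j = a *+ (i == j).

Lemma upper_trigM n a b (M N : 'M[F]_n) :
  upper_trig a M -> upper_trig b N -> upper_trig (a * b) (M *m N).
Proof.
move=> uM uN i j ji; rewrite mxE (bigD1 i) //= big1 => [|l li]; last first.
  have [il|il] := leqP l i; first by rewrite uM // eq_sym (negPf li) mul0r.
  rewrite (uN l j) ?(leq_trans ji (ltnW il)) //.
  by case: eqVneq il ji => [->|_]; rewrite ?mulr0 // ltnNge => /negPf->.
by rewrite uM // (uN i j) // eqxx addr0 mulrnAr.
Qed.

Lemma upper_trigD n a b (M N : 'M[F]_n) :
  upper_trig a M -> upper_trig b N -> upper_trig (a + b) (M + N).
Proof. by move=> uM uN i j ji; rewrite mxE uM // uN // mulrnDl. Qed.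

Lemma upper_trig_scalar n a : upper_trig a (a%:M : 'M[F]_n).
Proof. by move=> i j _; rewrite mxE. Qed.

Lemma upper_trigX n a (M : 'M[F]_n) k :
  upper_trig a M -> upper_trig (a ^+ k) (M ^+ k).
Proof.
move=> uM; elim: k => [|k IH]; first exact: upper_trig_scalar.
by rewrite !exprS; apply: upper_trigM.
Qed.

Lemma upper_trig_jordan_block k l : upper_trig l (jordan_block k l : 'M[F]_k).
Proof. by move=> i j ji; rewrite mxE gtn_eqF ?addr0. Qed.

Lemma upper_trig_hornermx n p a (M : 'M[F]_n) :
  upper_trig a M -> upper_trig p.[a] (hornermx p M).
Proof.
move=> uM; elim/poly_ind: p => [|p c IH].
  by rewrite hornermx0 horner0 => i j _; rewrite mxE mul0rn.
rewrite hornermx_MXaddC hornerMXaddC.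
by apply: upper_trigD (upper_trig_scalar _); apply: upper_trigM.
Qed.

Lemma jordan_blockE k l : jordan_block k l = l%:M + jordan_block k 0 :> 'M[F]_k.
Proof. by apply/matrixP => i j; rewrite !mxE mul0rn add0r. Qed.

Lemma jordan_block0_mul k (M : 'M[F]_k) (i j : 'I_k) (lt : (i.+1 < k)%N) :
  (jordan_block k 0 *m M) i j = M (Ordinal lt) j.
Proof.
rewrite mxE (bigD1 (Ordinal lt)) //= mxE mul0rn add0r eqxx mul1r.
rewrite big1 ?addr0 // => l; rewrite -val_eqE /= eq_sym => /negPf ne.
by rewrite mxE ne mul0rn addr0 mul0r.
Qed.

Lemma jordan_block0_mul_last k (M : 'M[F]_k) (i j : 'I_k) : (k <= i.+1)%N ->
  (jordan_block k 0 *m M) i j = 0.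
Proof.
move=> le; rewrite mxE big1 // => l _; rewrite mxE mul0rn add0r.
by rewrite gtn_eqF ?mul0r // (leq_trans (ltn_ord l)).
Qed.

(* With [E] the nilpotent block and [p - p.[l] = ('X - l) * q], the nilpotent
   part of [p] at the block is [N = E Q], with [Q] upper triangular and
   invertible.  The first basis row [e_0] is a cyclic vector for [N]: row [i] of
   [S] is [e_0 N^i = e_i Q^i]. *)
Lemma hornermx_jordan_block k l p : p^`().[l] != 0 ->
  similarity_orbit (jordan_block k p.[l]) (hornermx p (jordan_block k l)).
Proof.
have /factor_theorem[q eq] : root (p - p.[l]%:P) l.
  by rewrite rootE !hornerE subrr.
have {eq}ep : p = q * ('X - l%:P) + p.[l]%:P by rewrite -eq subrK.
have -> : p^`().[l] = q.[l].
  by rewrite [in LHS]ep !derivE !hornerE subrr mulr0 add0r.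
move=> ql0; set J := jordan_block k l; set Q := hornermx q J.
set E := jordan_block k (0 : F).
have JE : J - l%:M = E by rewrite /J jordan_blockE addrC addKr.
have pJ : hornermx p J = Q *m E + p.[l]%:M.
  by rewrite {1}ep hornermxD hornermxM hornermxD -polyCN !hornermxC hornermxX
             raddfN /= JE.
have QE : E *m Q = Q *m E.
  rewrite -JE; apply: hornermx_intertwine.
  by rewrite mulmxBl mulmxBr scalar_mxC.
have uQ : upper_trig q.[l] Q.
  by apply: upper_trig_hornermx; apply: upper_trig_jordan_block.
have QiE i : (Q ^+ i) *m (Q *m E) = E *m Q ^+ i.+1.
  elim: i => [|i IH]; first by rewrite mul1mx expr1 QE.
  by rewrite {1}exprS -[Q * _]/(Q *m _) -mulmxA IH mulmxA -QE -mulmxA -[Q *m _]exprS.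
apply/similarity_orbitP; pose S : 'M[F]_k := \matrix_(i, j) (Q ^+ i) i j.
exists S.
  (* Row [i] of [Q ^+ i] vanishes before column [i], where it equals [q.[l] ^+ i]; hence [S] is
     upper triangular with nonzero diagonal. The transpose is taken because [det_trig] concerns
     lower triangular matrices. *)
  rewrite unitmxE -det_tr det_trig; last first.
    apply/is_trig_mxP => i j ij; rewrite !mxE (upper_trigX j uQ) ?(ltnW ij) //.
    by rewrite -val_eqE gtn_eqF.
  rewrite unitfE; apply/prodf_neq0 => i _.
  by rewrite !mxE (upper_trigX i uQ) // eqxx mulr1n expf_neq0.
rewrite pJ (jordan_blockE k p.[l]) -/E mulmxDr mulmxDl scalar_mxC [RHS]addrC.
congr (_ + _); apply/matrixP => i j.
transitivity ((Q ^+ i *m (Q *m E)) i j).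
  by rewrite !mxE; apply: eq_bigr => t _; rewrite mxE.
(* Left multiplication by [E] shifts rows up by one: row [i] of [E *m Q ^+ i.+1] is row [i.+1] of
   [Q ^+ i.+1], which is row [i.+1] of [S]. For the last row both sides are 0. *)
rewrite QiE; have [le|lt] := leqP k i.+1.
  by rewrite !jordan_block0_mul_last.
by rewrite !jordan_block0_mul mxE.
Qed.

Lemma hornermx_jordan_form n (s : jordan_structure n) (l : 'I_(js_r s) -> F) p :
  (forall i, p^`().[l i] != 0) ->
  similarity_orbit (jordan_form (fun i => p.[l i])) (hornermx p (jordan_form l)).
Proof.
move=> pl; rewrite /jordan_form hornermx_castmx; apply: similarity_orbit_castmx.
rewrite hornermx_mxdiag; apply: similarity_orbit_mxdiag => i.
rewrite hornermx_mxdiag; apply: similarity_orbit_mxdiag => j.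
exact: hornermx_jordan_block.
Qed.

Lemma hornermx_orbit_jordan_form n (s : jordan_structure n)
    (l : 'I_(js_r s) -> F) p (M : 'M[F]_n) :
  (forall i, p^`().[l i] != 0) -> similarity_orbit (jordan_form l) M ->
  similarity_orbit (jordan_form (fun i => p.[l i])) (hornermx p M).
Proof.
move=> pl lM; apply: similarity_orbit_trans (hornermx_jordan_form pl) _.
exact: similarity_orbit_hornermx.
Qed.

Lemma lagrange_basis r (l : 'I_r -> F) : injective l ->
  exists L : 'I_r -> {poly F}, forall i j, (L i).[l j] = (i == j)%:R.
Proof.
move=> lI; exists (fun i => (\prod_(j | j != i) (l i - l j))^-1 *:
                            \prod_(j | j != i) ('X - (l j)%:P)) => i j.
rewrite hornerZ horner_prod; case: eqVneq => [<-|ij].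
  under [X in _ * X]eq_bigr do rewrite hornerXsubC.
  rewrite mulVf //; apply/prodf_neq0 => t ti.
  by rewrite subr_eq0 (inj_eq lI) eq_sym.
by rewrite [X in _ * X](bigD1 j) ?(eq_sym j) //= hornerXsubC subrr mul0r mulr0.
Qed.

Lemma hermite_interpolation r (l m : 'I_r -> F) : injective l ->
  exists p : {poly F}, forall i, p.[l i] = m i /\ p^`().[l i] = 1.
Proof.
move=> /lagrange_basis[L LE].
(* [3 t^2 - 2 t^3] fixes 0 and 1, where its derivative vanishes. *)
pose h i := L i ^+ 2 *+ 3 - L i ^+ 3 *+ 2.
have hE i j : (h i).[l j] = (i == j)%:R.
  rewrite /h !hornerE LE.
  by case: eqP => _ /=; ring.
have h'E i j : (h i)^`().[l j] = 0.
  rewrite /h derivB !derivMn !deriv_exp !hornerE LE.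
  by case: eqP => _ /=; ring.
(* ['X] already has derivative 1; each correction moves the value at its own node from [l i] to
   [m i] and leaves all the derivatives at the nodes unchanged. *)
exists ('X + \sum_i (m i - l i) *: h i) => j; split.
  rewrite !hornerE horner_sum (bigD1 j) //= big1 => [|i ij].
    by rewrite hornerZ hE eqxx mulr1 addr0 addrC subrK.
  by rewrite hornerZ hE (negPf ij) mulr0.
rewrite derivD derivX hornerD hornerC raddf_sum horner_sum big1 ?addr0 //= => i _.
by rewrite derivZ hornerZ h'E mulr0.
Qed.

End jordan.

(** * Closures of bundles *)

Section closure_of_bundles.
Variable K : numFieldType.

Section continuous_matrix.
Variables (T : topologicalType) (x : T).

(** A neighbourhood of a matrix contains a box of neighbourhoods of its entries, and finitely many
    entry conditions can be met simultaneously. *)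
Lemma continuous_mx m n (f : T -> 'M[K]_(m, n)) :
  (forall i j, {for x, continuous (fun t => f t i j)}) -> {for x, continuous f}.
Proof.
move=> cf A [P fP PA]; apply: filterS (fun t => PA (f t)) _ => /=.
by apply: filter_forall => i; apply: filter_forall => j; exact: cf (fP i j).
Qed.

Lemma continuous_coord m n (f : T -> 'M[K]_(m, n)) i j :
  {for x, continuous f} -> {for x, continuous (fun t => f t i j)}.
Proof. move=> cf; exact: (continuous_comp cf (@coord_continuous K m n i j _)). Qed.

Lemma continuous_mulmx m n p (f : T -> 'M[K]_(m, n)) (g : T -> 'M[K]_(n, p)) :
  {for x, continuous f} -> {for x, continuous g} ->
  {for x, continuous (fun t => f t *m g t)}.
Proof.
move=> cf cg; apply: continuous_mx => i j.
rewrite /prop_for /continuous_at mxE; under boolp.eq_fun do rewrite mxE.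
apply: cvg_big => [|k _]; first exact: add_continuous.
by apply: cvgM; exact: continuous_coord.
Qed.

Lemma continuous_addmx m n (f g : T -> 'M[K]_(m, n)) :
  {for x, continuous f} -> {for x, continuous g} ->
  {for x, continuous (fun t => f t + g t)}.
Proof.
move=> cf cg; apply: continuous_mx => i j.
rewrite /prop_for /continuous_at mxE; under boolp.eq_fun do rewrite mxE.
by apply: cvgD; exact: continuous_coord.
Qed.

End continuous_matrix.

Lemma hornermx_continuous n (p : {poly K}) :
  continuous (hornermx p : 'M[K]_n -> 'M[K]_n).
Proof.
elim/poly_ind: p => [|p c IH] M.
  rewrite (_ : hornermx 0 = fun=> 0); first exact: cst_continuous.
  by apply: boolp.funext => X; rewrite hornermx0.
rewrite (_ : hornermx _ = fun X => hornermx p X *m X + c%:M); last first.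
  by apply: boolp.funext => X; rewrite hornermx_MXaddC.
apply: (@continuous_addmx _ M _ _ (fun X => hornermx p X *m X)); last first.
  exact: cst_continuous.
by apply: (@continuous_mulmx _ M _ _ _ (hornermx p) id); [exact: IH|exact: cvg_id].
Qed.

(** A nonzero affine function of [e] has at most one zero: it is either 0 itself, which the
    punctured filter excludes, or away from 0, which continuity excludes. *)
Lemma dnbhs0_affine_neq0 (a b : K) : (a != 0) || (b != 0) ->
  \forall e \near 0^', a + e * b != 0.
Proof.
have [->/=|a0 _] := eqVneq a 0.
  move=> b0; near=> e; rewrite add0r mulf_neq0 //.
  by near: e; exact: nbhs_dnbhs_neq.
have ce : {for 0, continuous (fun e : K => a + e * b)}.
  apply: continuousD; first exact: cst_continuous.
  by apply: continuousM; [exact: cvg_id|exact: cst_continuous].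
apply: nbhs_dnbhs; apply: (cvgr_neq0 _ ce) => /=.
by rewrite mul0r addr0.
Unshelve. all: by end_near. Qed.

(** The point 0 is not isolated in [K], so [0^'] is a proper filter and each neighbourhood of [f 0]
    contains some [f e] lying in [A]. *)
Lemma dnbhs0_closure (V : topologicalType) (f : K -> V) (A : set V) :
  {for 0, continuous f} -> (\forall e \near 0^', A (f e)) -> closure A (f 0).
Proof.
move=> cf Af W /cf /nbhs_dnbhs fW.
have [e []] := filter_ex (filterI Af fW).
by exists (f e).
Qed.

Lemma closure_bundle_hornermx n (p : {poly K}) (C X : 'M[K]_n) :
  bundle C X -> closure (bundle C) (hornermx p X).
Proof.
move=> [s [l [m [lI lC mI mX]]]].
pose f (e : K) : 'M[K]_n := hornermx p X + e%:M *m X.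
have -> : hornermx p X = f 0 by rewrite /f raddf0 mul0mx addr0.
have fE e : f e = hornermx (p + e%:P * 'X) X.
  by rewrite /f hornermxD hornermxM hornermxC hornermxX.
apply: dnbhs0_closure.
  apply: continuous_addmx; first exact: cst_continuous.
  apply: continuous_mulmx; last exact: cst_continuous.
  apply: continuous_mx => i j.
  rewrite /prop_for /continuous_at mxE; under boolp.eq_fun do rewrite mxE.
  by case: eqP => _; [exact: cvg_id|exact: cst_continuous].
(* The values of [p + e%:P * 'X] at two eigenvalues differ by an affine function of [e], whose slope
   [m i - m j] is nonzero. *)
have sep : \forall e \near 0^', forall i j, i != j ->
    p.[m i] - p.[m j] + e * (m i - m j) != 0.
  apply: filter_forall => i; apply: filter_forall => j.
  have [->|ij] := eqVneq i j; first exact: nearW.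
  apply: filterS (dnbhs0_affine_neq0 (a := p.[m i] - p.[m j]) (b := m i - m j) _).
    by move=> e ne _.
  by rewrite orbC subr_eq0 (inj_eq mI) ij.
(* The derivative at [m i] is affine in [e] with slope 1. *)
have der : \forall e \near 0^', forall i, p^`().[m i] + e * 1 != 0.
  by apply: filter_forall => i; apply: dnbhs0_affine_neq0; rewrite oner_neq0 orbT.
apply: filterS2 sep der => e sep der.
rewrite fE; exists s, l, (fun i => (p + e%:P * 'X).[m i]); split => //.
- move=> i j; apply: contra_eq => /sep.
  by rewrite mulrBr addrACA -opprD subr_eq0 !hornerE.
- apply: hornermx_orbit_jordan_form mX => i.
  by have := der i; rewrite derivD derivM derivX derivC mul0r add0r mulr1 mulr1 !hornerE.
Qed.

Lemma closure_image (V W : topologicalType) (f : V -> W) (A : set V) (B : set W) x :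
  continuous f -> (forall y, A y -> closure B (f y)) -> closure A x ->
  closure B (f x).
Proof.
(* Replacing [closure B] by its own closure makes it enough to find, in each neighbourhood of [f x],
   a point of [closure B] rather than of [B]. *)
move=> cf AB Ax; rewrite ((closure_id _).1 (@closed_closure _ B)) => N /cf Nfx.
by have [y [Ay Ny]] := Ax _ Nfx; exists (f y); split => //; exact: AB.
Qed.

Lemma bundle_orbit n (C X Y : 'M[K]_n) :
  similarity_orbit X Y -> bundle C X -> bundle C Y.
Proof.
move=> XY [s [l [m [lI lC mI mX]]]]; exists s, l, m; split => //.
exact: similarity_orbit_trans mX XY.
Qed.

(** Conjugation by a fixed [S] is continuous and maps the bundle into itself, hence also its
    closure. *)
Lemma closure_bundle_orbit n (C X Y : 'M[K]_n) :
  similarity_orbit X Y -> closure (bundle C) X -> closure (bundle C) Y.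
Proof.
move=> [S /= uS <-] CX.
apply: (closure_image (f := fun M => invmx S *m M *m S)) CX.
  move=> M; apply: continuous_mulmx; last exact: cst_continuous.
  by apply: continuous_mulmx; [exact: cst_continuous|exact: cvg_id].
move=> M CM; apply: subset_closure; apply: bundle_orbit CM.
by exists S.
Qed.

Lemma closure_bundle_trans n (A B C : 'M[K]_n) :
  bundle B A -> closure (bundle C) B -> closure (bundle C) A.
Proof.
move=> [s [l [m [lI lB _ mA]]]] CB.
have [p pE] := hermite_interpolation m lI.
have em : (fun i => p.[l i]) = m by apply/boolp.funext => i; rewrite (pE i).1.
have mpB : similarity_orbit (jordan_form m) (hornermx p B).
  by rewrite -em; apply: hornermx_orbit_jordan_form lB => i; rewrite (pE i).2 oner_neq0.
apply: closure_bundle_orbit (similarity_orbit_trans (similarity_orbit_sym mpB) mA) _.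
apply: closure_image CB; first exact: hornermx_continuous.
by move=> X; exact: closure_bundle_hornermx.
Qed.

End closure_of_bundles.

Theorem theorem4p1 (R : realType) (n : nat) (A B C : 'M[R[i]]_n) :
  bundle B A -> closure (bundle C) B -> closure (bundle C) A.
Proof. exact: closure_bundle_trans. Qed.
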